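(* For every integer $n\ge 1$, as polynomials in $x$, $$\frac{d}{dx}B_{n}^{L}(x)=\sum_{m=0}^{n-1}\binom{n}{m}(n-m)!\,B_{m}^{L}(x).$$
   Context: For integers $n,k\ge 0$, the unsigned Lah number $L(n,k)$ is the number of ways a set of $n$ elements can be partitioned into $k$ nonempty linearly ordered subsets (so $L(0,0)=1$, $L(n,0)=0$ for $n\ge 1$, $L(n,k)=0$ for $k>n$, and $L(n,k)=\binom{n-1}{k-1}\frac{n!}{k!}$ for $n\ge k\ge 1$). The Lah-Bell polynomials are $B_n^L(x)=\sum_{l=0}^n L(n,l)x^l$ for $n\ge 0$. *)

(* Defs.v *)
From mathcomp Require Import all_boot all_order all_algebra.

Set Implicit Arguments.
Unset Strict Implicit.
Unset Printing Implicit Defensive.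

Import GRing.Theory.
Local Open Scope ring_scope.

(* A nonempty linearly ordered subset of T is the nonempty duplicate-free
   sequence listing it in increasing order.  The length bound #|T| of the bseq
   type only serves to make that type finite: every duplicate-free sequence
   over T satisfies it. *)
Definition ordered_block (T : finType) (s : #|T|.-bseq T) : bool :=
  (0 < size s)%N && uniq s.

(* The blocks are disjoint and cover T: each x lies in exactly one of them. *)
Definition ordered_partition (T : finType) (S : {set #|T|.-bseq T}) : bool :=
  [forall s in S, ordered_block s]
  && [forall x : T, #|[set s in S | x \in s]| == 1%N].

Definition lah (n k : nat) : nat :=
  #|[set S : {set #|'I_n|.-bseq 'I_n} | ordered_partition S & #|S| == k]|.

Definition lah_bell (R : comNzRingType) (n : nat) : {poly R} :=
  \sum_(l < n.+1) (lah n l)%:R *: 'X^l.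

(* Main.v *)
Require Import Defs.
From mathcomp Require Import all_boot all_order all_algebra.

Set Implicit Arguments.
Unset Strict Implicit.
Unset Printing Implicit Defensive.

Import GRing.Theory.
Local Open Scope nat_scope.

(** Comparing the coefficients of ['X^k] on both sides, the theorem amounts to
    the recurrence
      (k + 1) L(n, k + 1) = \sum_(m < n) C(n, m) (n - m)! L(m, k),
    which is [lah_rec].  Both sides count the ordered partitions of an
    n-element set into k + 1 blocks in which one block is marked.  Choosing the
    partition and then the mark gives the left side.  Choosing the marked block
    first, as a duplicate-free sequence of n - m elements, can be done in
    n ^_ (n - m) = C(n, m) (n - m)! ways ([card_uniq_bseq]); what remains is an
    ordered partition into k blocks of the m elements outside of that block
    ([card_partitions_with_block]).

    This needs partitions of a subset of the ambient type; that their number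
    depends only on the cardinality of the subset is [card_partitions_of], by
    transport along an enumeration of the subset.  The recurrence also yields
    L(n, k) = 0 for k > n, so that the sums defining the polynomials
    have the coefficients L(n, k) in every degree. *)

(** * Ordered partitions of a subset *)

(** The covered subset [A] is kept inside the fixed type [T], so that removing
    a block changes neither the type of the elements nor the length bound. *)
Definition partition_of (T : finType) (A : {set T}) (S : {set #|T|.-bseq T}) :=
  [forall s in S, ordered_block s]
  && [forall x : T, #|[set s in S | x \in s]| == (x \in A) :> nat].

Definition partitions_of (T : finType) (A : {set T}) (k : nat) :=
  [set S : {set #|T|.-bseq T} | partition_of A S & #|S| == k].

Lemma partition_ofP (T : finType) (A : {set T}) (S : {set #|T|.-bseq T}) :
  reflect ((forall s, s \in S -> ordered_block s) /\
           (forall x, #|[set s in S | x \in s]| = (x \in A)))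
          (partition_of A S).
Proof.
apply: (iffP andP) => [[/forall_inP Sb /forallP SA]|[Sb SA]]; split=> //.
- by move=> x; apply/eqP.
- exact/forall_inP.
- by apply/forallP => x; apply/eqP.
Qed.

Lemma partition_of_mem (T : finType) (A : {set T}) (S : {set #|T|.-bseq T}) s x :
  partition_of A S -> s \in S -> x \in s -> x \in A.
Proof.
case/partition_ofP => _ SA sS xs; move: (SA x); case: (x \in A) => // /eqP.
by rewrite cards_eq0 => /eqP/setP/(_ s); rewrite !inE sS xs.
Qed.

Lemma lahE (n k : nat) : lah n k = #|partitions_of [set: 'I_n] k|.
Proof.
apply: eq_card => S; rewrite !inE; congr (_ && _); congr (_ && _).
by apply: eq_forallb => x; rewrite inE.
Qed.

(** * Transport of partitions along an injection *)

Section Transport.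

Variables (T' T : finType) (f : T' -> T).
Hypothesis f_inj : injective f.

Definition map_block (s : #|T'|.-bseq T') : #|T|.-bseq T :=
  insub_bseq #|T| (map f s).

Lemma bseq_map_block s : map_block s = map f s :> seq T.
Proof.
apply: insubdK; rewrite -topredE /= size_map (leq_trans (size_bseq s)) //.
exact: leq_card f_inj.
Qed.

Lemma map_block_inj : injective map_block.
Proof.
move=> s1 s2 /(congr1 val) /=; rewrite !bseq_map_block => /(inj_map f_inj).
exact: val_inj.
Qed.

Lemma mem_map_block s x : (f x \in map_block s) = (x \in s).
Proof. by rewrite !membsE bseq_map_block mem_map. Qed.

Lemma ordered_map_block s : ordered_block (map_block s) = ordered_block s.
Proof.
by rewrite /ordered_block bseq_map_block size_map map_inj_uniq.
Qed.

Lemma partition_map_block (S : {set #|T'|.-bseq T'}) :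
  partition_of (f @: [set: T']) (map_block @: S) = partition_of [set: T'] S.
Proof.
(* The blocks through [f x] are the images of the blocks through [x]. *)
have fiberE x : #|[set s in map_block @: S | f x \in s]| =
                #|[set s in S | x \in s]|.
  rewrite -(card_imset _ map_block_inj); apply: eq_card => s.
  rewrite !inE; apply/andP/imsetP => [[/imsetP[t tS ->]]|[t]].
    by rewrite mem_map_block => xt; exists t; rewrite ?inE ?tS.
  by rewrite inE => /andP[tS xt] ->; rewrite imset_f ?mem_map_block.
apply/partition_ofP/partition_ofP => -[Sb SA]; split.
- by move=> s sS; rewrite -ordered_map_block; apply/Sb/imset_f.
- by move=> x; rewrite -fiberE SA imset_f ?inE.
- by move=> _ /imsetP[s sS ->]; rewrite ordered_map_block Sb.
move=> y; have [/imsetP[x _ ->]|fy] := boolP (y \in f @: _).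
  by rewrite fiberE SA inE.
apply/eqP; rewrite cards_eq0; apply/eqP/setP => s; rewrite !inE.
apply/andP => -[/imsetP[t _ ->]].
rewrite membsE bseq_map_block => /mapP[x _ yE].
by rewrite yE imset_f ?inE in fy.
Qed.

(** The only obstacle to pulling [s] back is the length bound of the smaller
    type, and duplicate-freeness makes that bound automatic. *)
Lemma map_block_onto (s : #|T|.-bseq T) :
  uniq s -> {subset s <= f @: [set: T']} -> exists t, s = map_block t.
Proof.
move=> us sA.
have [t tE] : exists t, map f t = s :> seq T.
  have : {subset (s : seq T) <= f @: [set: T']} by [].
  elim: (s : seq T) => [|y r IHr] rA; first by exists [::].
  have /imsetP[x _ ->] := rA y (mem_head y r).
  have [|t <-] := IHr; last by exists (x :: t).
  by move=> z zr; apply: rA; rewrite inE zr orbT.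
have ut : uniq t by rewrite -(map_inj_uniq f_inj) tE.
have st : size t <= #|T'| by rewrite -(card_uniqP ut) max_card.
by exists (Bseq st); apply: val_inj; rewrite /= bseq_map_block tE.
Qed.

Lemma card_partitions_map k :
  #|partitions_of (f @: [set: T']) k| = #|partitions_of [set: T'] k|.
Proof.
rewrite -(card_imset _ (imset_inj map_block_inj)); apply: eq_card => S.
apply/idP/imsetP => [|[S' SS' ->]]; last first.
  move: SS'; rewrite !inE partition_map_block card_imset //.
  exact: map_block_inj.
rewrite inE => /andP[SA Sk].
have SE : S = map_block @: (map_block @^-1: S).
  apply/setP => s; apply/idP/imsetP => [sS|[t]]; last by rewrite inE => ? ->.
  have [|| t tE] := @map_block_onto s.
  - by have [Sb _] := partition_ofP _ _ SA; case/andP: (Sb s sS).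
  - by move=> x; apply: partition_of_mem SA sS.
  by exists t; rewrite ?inE -?tE.
exists (map_block @^-1: S) => //; rewrite inE -partition_map_block -SE SA.
by rewrite -(card_imset _ map_block_inj) -SE.
Qed.

End Transport.

(** The subset [A] is the image of ['I_#|A|] under its enumeration. *)
Lemma card_partitions_of (T : finType) (A : {set T}) k :
  #|partitions_of A k| = lah #|A| k.
Proof.
rewrite lahE -(card_partitions_map (@enum_val_inj T (mem A))).
congr #|pred_of_set (partitions_of _ k)|.
apply/setP => x; apply/idP/imsetP => [xA|[i _ ->]]; last exact: enum_valP.
by exists (enum_rank_in xA x); rewrite ?enum_rankK_in.
Qed.

(** * Marking a block *)

Lemma card_uniq_bseq (T : finType) (N j : nat) : j <= N ->
  #|[set s : N.-bseq T | (size s == j) && uniq s]| = #|T| ^_ j.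
Proof.
move=> jN; pose g (t : j.-tuple T) : N.-bseq T := insub_bseq N t.
have gE t : g t = t :> seq T by apply: insubdK; rewrite -topredE /= size_tuple.
have g_inj : injective g.
  by move=> t1 t2 /(congr1 val) /=; rewrite !gE => /val_inj.
rewrite -(card_uniq_tuples j (predT : pred T)) -(card_imset _ g_inj).
apply: eq_card => s; rewrite inE; apply/andP/imsetP => [[sj us]|[t]].
  exists (Tuple sj); first by rewrite inE us andbT; apply/allP.
  by apply: val_inj; rewrite /= gE.
by rewrite inE => /andP[_ ut] ->; rewrite gE size_tuple.
Qed.

(** Deleting the block [b] is a bijection from the partitions of [T] that
    contain [b] onto the partitions of the complement of [b]: such a partition
    of the complement cannot already contain [b], since [b] is nonempty. *)
Lemma card_partitions_with_block (T : finType) (b : #|T|.-bseq T) k :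
  ordered_block b ->
  #|[set S in partitions_of [set: T] k.+1 | b \in S]| =
  #|partitions_of (~: [set x in b]) k|.
Proof.
move=> bb.
have bP (S : {set #|T|.-bseq T}) : b \notin S ->
    partition_of [set: T] (b |: S) = partition_of (~: [set x in b]) S.
  move=> bS.
  have cE x : #|[set s in b |: S | x \in s]| =
              (x \in b) + #|[set s in S | x \in s]|.
    have [xb|xb] := boolP (x \in b).
      rewrite (_ : [set s in b |: S | x \in s] = b |: [set s in S | x \in s]).
        by rewrite cardsU1 !inE (negbTE bS).
      by apply/setP => s; rewrite !inE; case: eqP => // ->; rewrite xb.
    apply: eq_card => s; rewrite !inE; case: eqP => // ->.
    by rewrite (negbTE bS) (negbTE xb).
  apply/partition_ofP/partition_ofP => -[Sb SA]; split.
  - by move=> s sS; apply: Sb; rewrite inE sS orbT.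
  - by move=> x; move: (SA x); rewrite cE !inE; case: (x \in b) => [[]|].
  - by move=> s; rewrite !inE => /orP[/eqP->|/Sb].
  - by move=> x; rewrite cE SA !inE; case: (x \in b).
have bN S : S \in partitions_of (~: [set x in b]) k -> b \notin S.
  rewrite inE => /andP[SA _]; apply/negP => bS.
  case/andP: bb; case bE: (bseqval b) => [//|x r] _ _.
  have xb : x \in b by rewrite membsE bE mem_head.
  by have := partition_of_mem SA bS xb; rewrite !inE xb.
have addb_inj :
    {in partitions_of (~: [set x in b]) k &, injective (setU [set b])}.
  by move=> S1 S2 /bN b1 /bN b2 E; rewrite -(setU1K b1) E setU1K.
rewrite -(card_in_imset addb_inj); apply: eq_card => S.
apply/idP/imsetP => [|[S' S'P ->]].
  rewrite !inE => /andP[/andP[SA Sk] bS]; exists (S :\ b); last by rewrite setD1K.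
  rewrite inE -bP ?setD1K // ?SA; last by rewrite !inE eqxx.
  by rewrite (cardsD1 b) bS in Sk.
have bS' := bN _ S'P; move: S'P.
by rewrite !inE eqxx andbT bP // cardsU1 bS'.
Qed.

(** * The recurrence for the Lah numbers *)

Lemma eqn_subr (n a m : nat) : a <= n -> m <= n -> (a == n - m) = (m == n - a).
Proof.
by move=> an mn; rewrite -{1}(subKn an) eqn_sub2lE ?leq_subr // eq_sym.
Qed.

(** The index [m] counts the elements outside of the marked block, whose size
    [n - m] is positive because blocks are nonempty. *)
Lemma lah_rec (n k : nat) :
  k.+1 * lah n k.+1 = \sum_(m < n) 'C(n, m) * (n - m)`! * lah m k.
Proof.
pose marked b := [set S in partitions_of [set: 'I_n] k.+1 | b \in S].
(* Counting pairs of a partition and a block of it, by partition. *)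
have -> : k.+1 * lah n k.+1 = \sum_b #|marked b|.
  rewrite lahE mulnC -sum_nat_const.
  under [RHS]eq_bigr do rewrite -sum1dep_card.
  rewrite (exchange_big_dep (mem (partitions_of setT k.+1))) /=; last first.
    by move=> b S _ /andP[].
  apply: eq_bigr => S SP; rewrite SP /= sum1_card.
  by move: SP; rewrite inE => /andP[_ /eqP].
have markedE b : ordered_block b -> #|marked b| = lah (n - size b) k.
  move=> bb; rewrite /marked card_partitions_with_block // card_partitions_of.
  have -> : #|~: [set x in b]| = #|'I_n| - size b.
    rewrite cardsCs setCK cardsE; congr (_ - _).
    by case/andP: bb => _ /card_uniqP.
  by rewrite [X in X - _]card_ord.
rewrite (bigID (@ordered_block _)) /= [X in _ + X]big1 ?addn0; last first.
  move=> b /negP bN; apply/eqP; rewrite cards_eq0; apply/eqP/setP => S.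
  rewrite !inE; apply/negP => /andP[/andP[/partition_ofP[Sb _] _] /Sb].
  exact: bN.
(* Introducing [m] as a summation index lets the sums over [m] and over the
   marked block be exchanged. *)
have split_size b : ordered_block b ->
    #|marked b| = \sum_(m < n | size b == n - m) lah m k.
  move=> bb; rewrite markedE //; case/andP: bb => b0 _.
  have bn : size b <= n by rewrite -[leqRHS]card_ord size_bseq.
  have mn : n - size b < n by rewrite ltn_subrL b0 (leq_trans b0).
  rewrite (big_pred1 (Ordinal mn)) // => m; rewrite -[RHS]val_eqE /=.
  by apply: eqn_subr => //; apply: ltnW.
rewrite (eq_bigr _ split_size) (exchange_big_dep predT) //=.
apply: eq_bigr => m _; rewrite sum_nat_const; congr (_ * _).
have mn := ltn_ord m.
rewrite -bin_sub ?(ltnW mn) // bin_ffact -[X in X ^_ _]card_ord.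
rewrite -(@card_uniq_bseq _ #|'I_n|) ?card_ord ?leq_subr //.
apply: eq_card => b; rewrite !inE [LHS]/(_ \in _) /= /ordered_block.
by case: eqP => [->|]; rewrite ?andbF // subn_gt0 mn andbT.
Qed.

(** In the recurrence for L(n, k + 1) with n <= k, every m < n satisfies m < k,
    so all terms vanish by induction. *)
Lemma lah_small (n k : nat) : n < k -> lah n k = 0.
Proof.
elim/ltn_ind: n k => n IHn [//|k] nk.
apply/eqP; rewrite -(eqn_pmul2l (ltn0Sn k)) lah_rec muln0.
rewrite sum_nat_eq0; apply/forallP => m; apply/implyP => _.
by rewrite IHn ?muln0 // (leq_trans (ltn_ord m)).
Qed.

(** * Lah-Bell polynomials *)

Local Open Scope ring_scope.

Lemma coef_lah_bell (R : comNzRingType) (n k : nat) :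
  (lah_bell R n)`_k = (lah n k)%:R.
Proof.
rewrite /lah_bell -(poly_def n.+1 (fun l => (lah n l)%:R)) coef_poly ltnS.
by case: (leqP k n) => // /lah_small ->.
Qed.

Theorem theorem10 (R : comNzRingType) (n : nat) (hn : (1 <= n)%N) :
  (lah_bell R n)^`() =
    \sum_(m < n) ('C(n, m) * (n - m)`!)%:R *: lah_bell R m.
Proof.
apply/polyP => k; rewrite coef_deriv coef_lah_bell coef_sum.
rewrite -mulrnA mulnC lah_rec natr_sum; apply: eq_bigr => m _.
by rewrite coefZ coef_lah_bell -natrM.
Qed.
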